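(* For each $\alpha\in(0,1)$, \[ \|S_1(\mathbbm{1}_A)\|_\alpha\ge|A|^* \] holds for every Borel set $A\subset[0,1)$. Moreover, for each $\alpha\in(0,1)$ there exist a constant $C_\alpha>0$ and a sequence of sets $A_j\in\mathcal{D}$ with nonzero measure such that $\lim_{j\to\infty}|A_j|=0$ and \[ \|S_1(\mathbbm{1}_{A_j})\|_\alpha\le C_\alpha|A_j|\qquad\text{for all }j. \]
   Context: Work on $[0,1)$ with its Borel $\sigma$-algebra and Lebesgue measure $|\cdot|$; $|A|^*=\min\{|A|,1-|A|\}$. For $n\ge 0$ let $\mathcal{D}_n=\{[k/2^n,(k+1)/2^n): k=0,\dots,2^n-1\}$, let $\mathcal{F}_n$ be the $\sigma$-algebra generated by $\mathcal{D}_n$, and let $\mathcal{D}=\bigcup_{n\ge0}\mathcal{F}_n$. For $f\in L^1([0,1))$ put $f_n=\mathbb{E}(f\mid\mathcal{F}_n)$, $d_n=f_n-f_{n-1}$ for $n\ge1$, and $S_1(f)=\sum_{n\ge1}|d_n|\in[0,\infty]$. For $\alpha>0$, $\|g\|_\alpha=\big(\int_0^1|g|^\alpha\big)^{1/\alpha}$. *)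

(* Defs.v *)
From HB Require Import structures.
From mathcomp Require Import all_boot all_order all_algebra.
From mathcomp Require Import all_classical all_reals all_analysis.

Set Implicit Arguments.
Unset Strict Implicit.
Unset Printing Implicit Defensive.

Import Order.TTheory GRing.Theory Num.Theory.
Import numFieldNormedType.Exports.

Local Open Scope classical_set_scope.
Local Open Scope ring_scope.

(* The probability space [0,1) is rendered as the subset `[0, 1[ of R : its
   Borel sets are the Borel sets of R included in `[0, 1[, its measure is
   lebesgue_measure, and functions on it are functions on R whose values
   outside `[0, 1[ are never used. *)

Definition dyadic_interval (R : realType) (n k : nat) : set R :=
  `[k%:R / 2 ^+ n, k.+1%:R / 2 ^+ n[%classic.
Arguments dyadic_interval : clear implicits.

Definition dyadic_intervals (R : realType) (n : nat) : set (set R) :=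
  [set dyadic_interval R n k | k in [set k | (k < 2 ^ n)%N]].
Arguments dyadic_intervals : clear implicits.

Definition dyadic_sigma (R : realType) (n : nat) : set (set R) :=
  <<s `[0, 1[, dyadic_intervals R n >>.
Arguments dyadic_sigma : clear implicits.

Definition dyadic_algebra (R : realType) : set (set R) :=
  \bigcup_n dyadic_sigma R n.
Arguments dyadic_algebra : clear implicits.

(* g is a version of E(f | G) on [0,1), for G a sub-sigma-algebra of the Borel
   sigma-algebra of [0,1). *)
Definition is_cond_exp (R : realType) (G : set (set R)) (f g : R -> R) : Prop :=
  [/\ forall B : set R, measurable B -> G (`[0, 1[ `&` g @^-1` B),
      lebesgue_measure.-integrable `[0, 1[ (EFin \o g) &
      forall B, G B ->
        (\int[lebesgue_measure]_(x in B) (g x)%:E =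
         \int[lebesgue_measure]_(x in B) (f x)%:E)%E].

(* A chosen version. For G = dyadic_sigma R n and integrable f a version exists
   (cond_exp_dyadicP) and is unique at every point of [0,1)
   (is_cond_exp_dyadicE). *)
Definition cond_exp (R : realType) (G : set (set R)) (f : R -> R) : R -> R :=
  xget (fun=> 0) [set g | is_cond_exp G f g].

Section cond_exp_dyadic.
Variable R : realType.
Implicit Types (f g : R -> R) (B : set R).
Local Notation mu := (@lebesgue_measure R).
Local Notation I01 := (`[0%R, 1%R[%classic : set R).

Let index (n : nat) (x : R) : nat := Num.truncn (x * 2 ^+ n).

Let pow2_gt0 n : 0 < 2 ^+ n :> R. Proof. by rewrite exprn_gt0. Qed.

Let sub_dyadic n k : (k < 2 ^ n)%N -> dyadic_interval R n k `<=` I01.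
Proof.
move=> kn x; rewrite /dyadic_interval /= !in_itv/= => /andP[kx xk]; apply/andP; split.
  apply: (le_trans _ kx); rewrite divr_ge0// ltW.
by apply: lt_le_trans xk _; rewrite ler_pdivrMr// mul1r -natrX ler_nat.
Qed.

Let dyadicP n k x : 0 <= x -> dyadic_interval R n k x <-> index n x = k.
Proof.
move=> x0; rewrite /dyadic_interval /= in_itv/= ler_pdivrMr// ltr_pdivlMr//.
by rewrite -truncn_eq ?mulr_ge0// ?ltW//; split => /eqP.
Qed.

Let index_lt n x : I01 x -> (index n x < 2 ^ n)%N.
Proof.
rewrite /= in_itv/= => /andP[x0 x1].
by rewrite truncn_lt_nat ?mulr_ge0// ?ltW// natrX gtr_pMl.
Qed.

Let itv_ge0 x : I01 x -> 0 <= x.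
Proof. by rewrite /= in_itv/= => /andP[]. Qed.

Let dyadicE n k : (k < 2 ^ n)%N ->
  dyadic_interval R n k = I01 `&` index n @^-1` [set k].
Proof.
move=> kn; apply/seteqP; split=> x /=.
  move=> Ix; have x01 := sub_dyadic kn Ix.
  by split => //; apply/(dyadicP n k (itv_ge0 x01)).
by move=> [x01] /(dyadicP n k (itv_ge0 x01)).
Qed.

Let atoms n (K : set nat) k :=
  if `[< K k >] && (k < 2 ^ n)%N then dyadic_interval R n k else set0.

Let atomsE n (K : set nat) :
  I01 `&` index n @^-1` K = \bigcup_k atoms n K k.
Proof.
apply/seteqP; split=> x.
  move=> [x01 Kx]; exists (index n x) => //.
  rewrite /atoms (index_lt n x01) asboolT//=.
  by apply/(dyadicP n _ (itv_ge0 x01)).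
move=> [k _]; rewrite /atoms; case: ifPn => // /andP[/asboolP Kk kn].
by rewrite dyadicE// => -[x01 /= ->].
Qed.

Let measurable_atoms n K k : measurable (atoms n K k).
Proof. by rewrite /atoms; case: ifP => _; [exact: measurable_itv|]. Qed.

Let trivIset_atoms n K : trivIset setT (atoms n K).
Proof.
apply/trivIsetP => i j _ _; apply: contra_neqP => /eqP/set0P[x []].
rewrite /atoms; case: ifPn => // /andP[_ ni]; case: ifPn => // /andP[_ nj].
by rewrite !dyadicE// => -[_ /= <-] [_ /= <-].
Qed.

Lemma dyadic_sigmaE n B : dyadic_sigma R n B <->
  exists K : set nat, B = I01 `&` index n @^-1` K.
Proof.
split; last first.
  have sG := @smallest_sigma_algebra _ I01 (dyadic_intervals R n).
  move=> [K ->]; rewrite atomsE; case: sG => G0 _; apply => k.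
  rewrite /atoms; case: ifPn => // /andP[_ kn].
  by apply: sub_sigma_algebra; exists k.
move: B; apply: smallest_sub; last first.
  by move=> _ [k /= kn <-]; exists [set k]; rewrite dyadicE.
split.
- by exists set0; rewrite preimage_set0 setI0.
- move=> A [K ->]; exists (~` K); apply/seteqP; split => x /=.
    by move=> [x01 h]; split=> // Kx; apply: h.
  by move=> [x01 h]; split=> // -[].
- move=> A /choice[K AK]; exists (\bigcup_k K k).
  rewrite preimage_bigcup setI_bigcupr.
  by apply: eq_bigcupr => k _; exact: AK.
Qed.

Lemma dyadic_sigma_measurable n B : dyadic_sigma R n B -> measurable B.
Proof.
by move=> /dyadic_sigmaE[K ->]; rewrite atomsE; exact: bigcup_measurable.
Qed.

Lemma lebesgue_dyadic n k : mu (dyadic_interval R n k) = (2 ^- n)%:E.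
Proof.
rewrite lebesgue_measure_itv/= lte_fin ltr_pM2r ?invr_gt0// ltr_nat leqnn.
by rewrite -EFinB -mulrBl -natrB// subSnn div1r.
Qed.

Let integral_cst_dyadic n k (c : R) :
  (\int[mu]_(x in dyadic_interval R n k) (cst c%:E x) = (c / 2 ^+ n)%:E)%E.
Proof.
have := integral_cst mu (measurable_itv _ : measurable (dyadic_interval R n k)) c%:E.
by move=> ->; rewrite EFinM -(lebesgue_dyadic n k).
Qed.

Let avg n f k : R := 2 ^+ n * fine (\int[mu]_(x in dyadic_interval R n k) (f x)%:E).

Let is_cond_exp_avg n f : mu.-integrable I01 (EFin \o f) ->
  is_cond_exp (dyadic_sigma R n) f (avg n f \o index n).
Proof.
move=> intf.
have mg B : dyadic_sigma R n (I01 `&` (avg n f \o index n) @^-1` B).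
  by apply/dyadic_sigmaE; exists (avg n f @^-1` B).
have intg : mu.-integrable I01 (EFin \o (avg n f \o index n)).
  apply: measurable_bounded_integrable => //.
  - have : (mu I01 < +oo)%E; last by [].
    by rewrite lebesgue_measure_itv/= lte_fin ltr01 -EFinB ltry.
  - by move=> _ B mB; exact: dyadic_sigma_measurable (mg _).
  exists (\sum_(k < 2 ^ n) `|avg n f k|); split; first exact: num_real.
  move=> M ltM x x01; apply: le_trans (ltW ltM).
  rewrite (bigD1 (Ordinal (index_lt n x01)))//= lerDl.
  by apply: sumr_ge0.
split=> [B _|//|B /dyadic_sigmaE[K BE]]; first exact: mg.
have mB : measurable B by rewrite BE atomsE; exact: bigcup_measurable.
have B01 : B `<=` I01 by rewrite BE; exact: subIsetl.
have intS h D : measurable D -> D `<=` I01 -> mu.-integrable I01 (EFin \o h) ->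
    mu.-integrable D (EFin \o h).
  by move=> mD D01; apply: integrableS => //; exact: measurable_itv.
have := intS _ _ mB B01 intf; have := intS _ _ mB B01 intg.
rewrite BE atomsE => intgB intfB.
have sumE h : mu.-integrable (\bigcup_k atoms n K k) (EFin \o h) ->
    (\int[mu]_(x in \bigcup_k atoms n K k) (h x)%:E =
     \sum_(k <oo) \int[mu]_(x in atoms n K k) (h x)%:E)%E.
  by move=> inth; apply: (integral_bigcup (mu := mu)); [exact: trivIset_atoms|exact: measurable_atoms|].
rewrite (sumE _ intgB) (sumE _ intfB).
apply: eq_eseriesr => k _; rewrite /atoms; case: ifPn => [/andP[_ kn]|_]; last first.
  by rewrite !integral_set0.
rewrite (eq_integral (cst (avg n f k)%:E)); last first.
  by move=> x; rewrite inE dyadicE// => -[_ /= ->].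
rewrite integral_cst_dyadic /avg mulrAC mulfV ?gt_eqF// mul1r fineK//.
apply: integrable_fin_num; first exact: measurable_itv.
by apply: intS intf; [exact: measurable_itv|exact: sub_dyadic].
Qed.

Lemma cond_exp_dyadicP n f : mu.-integrable I01 (EFin \o f) ->
  is_cond_exp (dyadic_sigma R n) f (cond_exp (dyadic_sigma R n) f).
Proof.
by move=> /(is_cond_exp_avg n) fg; rewrite /cond_exp; case: xgetP => [g _ //|/(_ _ fg)].
Qed.

Lemma is_cond_exp_dyadicE n f g (k : nat) (x : R) :
  is_cond_exp (dyadic_sigma R n) f g ->
  (k < 2 ^ n)%N -> dyadic_interval R n k x ->
  g x = 2 ^+ n * \int[lebesgue_measure]_(y in dyadic_interval R n k) f y.
Proof.
move=> [mg _ intg] kn Ix.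
have /dyadic_sigmaE[K gK] := mg _ (measurable_set1 (g x)).
have [x01 xk] : (I01 `&` index n @^-1` [set k]) x by rewrite -dyadicE.
have Kk : K k.
  have : (I01 `&` g @^-1` [set g x]) x by [].
  by rewrite gK => -[_ /=]; rewrite xk.
have gx y : dyadic_interval R n k y -> g y = g x.
  rewrite dyadicE// => -[y01 /= yk].
  have : (I01 `&` index n @^-1` K) y by split=> //=; rewrite yk.
  by rewrite -gK => -[].
have Gk : dyadic_sigma R n (dyadic_interval R n k).
  by apply/dyadic_sigmaE; exists [set k]; rewrite dyadicE.
rewrite /Rintegral -(intg _ Gk) (eq_integral (cst (g x)%:E)); last first.
  by move=> y; rewrite inE => /gx ->.
by rewrite integral_cst_dyadic /= mulrCA mulfV ?mulr1// gt_eqF.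
Qed.

Lemma cond_exp_dyadicE n f (k : nat) (x : R) :
  mu.-integrable I01 (EFin \o f) ->
  (k < 2 ^ n)%N -> dyadic_interval R n k x ->
  cond_exp (dyadic_sigma R n) f x =
  2 ^+ n * \int[lebesgue_measure]_(y in dyadic_interval R n k) f y.
Proof. by move=> /(cond_exp_dyadicP n); exact: is_cond_exp_dyadicE. Qed.

End cond_exp_dyadic.

Definition dyadic_mart (R : realType) (f : R -> R) (n : nat) : R -> R :=
  cond_exp (dyadic_sigma R n) f.

Definition mart_diff (R : realType) (f : R -> R) (n : nat) (x : R) : R :=
  dyadic_mart f n x - dyadic_mart f n.-1 x.

Definition S1 (R : realType) (f : R -> R) (x : R) : \bar R :=
  (\sum_(1 <= n <oo) `|mart_diff f n x|%:E)%E.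

(* Extending g by 0 turns the integral over [0,1) into the integral over R
   used by Lnorm. *)
Definition norm01 (R : realType) (alpha : R) (g : R -> \bar R) : \bar R :=
  ('N[lebesgue_measure]_(alpha%:E)[g \_ `[0%R, 1%R[])%E.

Definition lebesgue_star (R : realType) (A : set R) : \bar R :=
  Order.min (lebesgue_measure A) (1 - lebesgue_measure A)%E.

(* Main.v *)
Require Import Defs.
From HB Require Import structures.
From mathcomp Require Import all_boot all_order all_algebra.
From mathcomp Require Import all_classical all_reals all_analysis.
From mathcomp Require Import measurable_realfun lra.

Set Implicit Arguments.
Unset Strict Implicit.
Unset Printing Implicit Defensive.

Import Order.TTheory GRing.Theory Num.Theory.
Import numFieldNormedType.Exports.

Local Open Scope classical_set_scope.
Local Open Scope ring_scope.

(* Lower bound: telescoping gives |f_n - f_0| <= S_1(f), and f_n -> f almost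
   everywhere by Lebesgue differentiation along dyadic intervals; hence
   S_1(1_A) >= |1_A - |A|| >= |A|^* almost everywhere.
   Upper bound: take A_N = [0, 2^-N). Then f_n <= 2^(n-N) 1_[0, 2^-n) for n <= N
   and f_n = f for n >= N, so S_1(f) <= 2 \sum_(n <= N) 2^(n-N) 1_[0, 2^-n).
   Subadditivity of t |-> t^alpha bounds the integral of S_1(f)^alpha by
   2^alpha 2^(-N alpha) \sum_n 2^(n (alpha - 1)), a convergent geometric series
   since alpha < 1. *)

Section dyadic_martingale.
Context {R : realType}.
Implicit Types (f : R -> R) (x : R) (A : set R).
Local Notation mu := (@lebesgue_measure R).
Local Notation I01 := (`[0%R, 1%R[%classic : set R).

(** * Dyadic intervals of [0,1): location, size and shrinking *)

Lemma ae_imply (P Q : R -> Prop) : (forall x, P x -> Q x) ->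
  {ae mu, forall x, P x} -> {ae mu, forall x, Q x}.
Proof. by move=> PQ; apply: negligibleS => x /= nQ Px; exact/nQ/PQ. Qed.

Lemma exp2_gt0 n : 0 < 2 ^+ n :> R. Proof. by rewrite exprn_gt0. Qed.

Lemma lebesgue_itv01 : mu I01 = 1%E.
Proof. by rewrite lebesgue_measure_itv/= lte_fin ltr01 oppr0 adde0. Qed.

Lemma sub_dyadic_itv01 n k : (k < 2 ^ n)%N -> dyadic_interval R n k `<=` I01.
Proof.
move=> kn x; rewrite /dyadic_interval /= !in_itv/= => /andP[kx xk]; apply/andP; split.
  by apply: le_trans kx; rewrite divr_ge0// ltW// exp2_gt0.
by apply: lt_le_trans xk _; rewrite ler_pdivrMr ?exp2_gt0// mul1r -natrX ler_nat.
Qed.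

Lemma measurable_dyadic n k : measurable (dyadic_interval R n k).
Proof. exact: measurable_itv. Qed.

Lemma mem_dyadic_truncn n x : 0 <= x ->
  dyadic_interval R n (Num.truncn (x * 2 ^+ n)) x.
Proof.
move=> x0; have xn : 0 <= x * 2 ^+ n by rewrite mulr_ge0// ltW// exp2_gt0.
rewrite /dyadic_interval /= in_itv/= ler_pdivrMr ?exp2_gt0//.
by rewrite ltr_pdivlMr ?exp2_gt0// truncn_itv.
Qed.

Lemma truncn_dyadic_lt n x : I01 x -> (Num.truncn (x * 2 ^+ n) < 2 ^ n)%N.
Proof.
rewrite /= in_itv/= => /andP[x0 x1].
rewrite truncn_lt_nat ?mulr_ge0 ?(ltW (exp2_gt0 _))//.
by rewrite natrX gtr_pMl ?exp2_gt0.
Qed.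

Lemma mem_dyadic n x : I01 x ->
  exists2 k, (k < 2 ^ n)%N & dyadic_interval R n k x.
Proof.
move=> x01; exists (Num.truncn (x * 2 ^+ n)); first exact: truncn_dyadic_lt.
by apply: mem_dyadic_truncn; move: x01; rewrite /= in_itv/= => /andP[].
Qed.

Lemma dyadic_interval_ball n k x y :
  dyadic_interval R n k x -> dyadic_interval R n k y -> ball x (2 ^- n) y.
Proof.
rewrite /dyadic_interval /= !in_itv/= -(@natr1 _ k) mulrDl mul1r => /andP[kx xk] /andP[ky yk].
by rewrite /ball/= ltr_norml; apply/andP; split; lra.
Qed.

Lemma integrable_indic01 A : measurable A -> mu.-integrable I01 (EFin \o \1_A).
Proof.
move=> mA; apply: measurable_bounded_integrable => //.
- by have : (mu I01 < +oo)%E by rewrite lebesgue_itv01 ltry.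
exists 1; split; first exact: num_real.
by move=> M M1 x _; rewrite /= ger0_norm ?indicE// (le_trans _ (ltW M1))// lern1 leq_b1.
Qed.

Lemma cvg_exp2V : 2 ^- n @[n --> \oo] --> (0 : R).
Proof.
rewrite (_ : (fun n => _) = (fun n => 2^-1 ^+ n)); last first.
  by apply/funext => n; rewrite exprVn.
by apply: cvg_expr; rewrite gtr0_norm ?invr_gt0// invf_lt1// ltr1n.
Qed.

(** * Almost everywhere convergence of the dyadic martingale *)

Lemma nicely_shrinking_dyadic (k : nat^nat) x :
  (forall n, dyadic_interval R n (k n) x) ->
  nicely_shrinking x (fun n => dyadic_interval R n (k n)).
Proof.
move=> kx; split; first by move=> n; exact: measurable_dyadic.
have e0 n : 0 < 2 ^- n :> R by rewrite invr_gt0 exp2_gt0.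
(* The interval need not be centred at [x], but it lies in the ball of radius 2^-n, whose measure 2
   * 2^-n is twice its own: hence the constant 2. *)
exists (2, fun n => PosNum (e0 n)); split => //=.
- exact: cvg_exp2V.
- by move=> n y; exact: dyadic_interval_ball.
- move=> n; rewrite lebesgue_measure_ball ?(ltW (e0 n))// lebesgue_dyadic.
  by rewrite -EFinM mulr_natl.
Qed.

Lemma nicely_shrinking_ball x :
  nicely_shrinking x (fun n => ball x (2 ^- n)).
Proof.
split; first by move=> n; exact: measurable_ball.
have e0 n : 0 < 2 ^- n :> R by rewrite invr_gt0 exp2_gt0.
exists (1, fun n => PosNum (e0 n)); split => //= [|n|n]; first exact: cvg_exp2V.
  exact: subset_refl.
by rewrite mul1e.
Qed.

(** The value f_n(x) is the average of [f] over the dyadic interval of generation [n] around [x], so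
    Lebesgue differentiation applies to [f] extended by 0. *)
Lemma dyadic_mart_cvg f : mu.-integrable I01 (EFin \o f) ->
  {ae mu, forall x, I01 x -> dyadic_mart f n x @[n --> \oo] --> f x}.
Proof.
move=> intf; have locf := integrable_locally_restrict (measurable_itv _) intf.
have := lebesgue_differentiation locf.
apply: ae_imply => x fx x01.
(* nice_lebesgue_differentiation needs a shrinking family at every real point;
   the balls used at negative points are irrelevant. *)
pose k (y : R) n := Num.truncn (y * 2 ^+ n).
pose E (y : R) n := if 0 <= y then dyadic_interval R n (k y n) else ball y (2 ^- n).
have hE y : nicely_shrinking y (E y).
  rewrite /E; have [y0|y0] := leP 0 y; last exact: nicely_shrinking_ball.
  by apply: nicely_shrinking_dyadic => n; exact: mem_dyadic_truncn.
have x0 : 0 <= x by move: x01; rewrite /= in_itv/= => /andP[].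
have := nice_lebesgue_differentiation hE locf fx.
rewrite patchE mem_set// => /fine_cvgP[_].
apply: cvg_trans; apply: near_eq_cvg; near=> n.
rewrite /= /E x0 lebesgue_dyadic inver gt_eqF ?invr_gt0 ?exp2_gt0// invrK.
rewrite /dyadic_mart (@cond_exp_dyadicE _ n f (k x n))//; last 2 first.
- exact: truncn_dyadic_lt.
- exact: mem_dyadic_truncn.
have sub := sub_dyadic_itv01 (truncn_dyadic_lt n x01).
(* The interval stays inside [0,1), so the extension by 0 does not alter the average. *)
have -> : (\int[mu]_(y in dyadic_interval R n (k x n)) ((f \_ I01) y)%:E =
    \int[mu]_(y in dyadic_interval R n (k x n)) (f y)%:E)%E.
  by apply: eq_integral => y /set_mem/sub y01; rewrite patchE mem_set.
rewrite fineM// integrable_fin_num//; first exact: measurable_dyadic.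
apply: integrableS intf => //; exact: measurable_itv.
Unshelve. all: by end_near. Qed.

(** * Measurability of [S1] and its pointwise lower bound *)

Lemma measurable_mart_diff f n : mu.-integrable I01 (EFin \o f) ->
  measurable_fun I01 (mart_diff f n).
Proof.
move=> intf; have mm m : measurable_fun I01 (dyadic_mart f m).
  have [_ /integrableP[mg _] _] := cond_exp_dyadicP m intf.
  exact/measurable_EFinP.
exact: measurable_funB.
Qed.

Lemma S1_ge0 f x : (0 <= S1 f x)%E.
Proof. by apply: nneseries_ge0 => n _ _; rewrite lee_fin. Qed.

Lemma measurable_S1 f : mu.-integrable I01 (EFin \o f) ->
  measurable_fun I01 (S1 f).
Proof.
move=> intf.
(* The lower summation bound 1 becomes a condition on the index, the form [ge0_emeasurable_sum]
   accepts. *)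
have -> : S1 f = fun x => (\sum_(n <oo | (0 < n)%N) `|mart_diff f n x|%:E)%E.
  by apply/funext => x; exact: (eseries_cond (fun n => `|mart_diff f n x|%:E)%E xpredT 1).
apply: (@ge0_emeasurable_sum _ _ _ _ (fun n x => `|mart_diff f n x|%:E)%E (fun n => (0 < n)%N)).
  by move=> n x _ _; rewrite lee_fin.
move=> n _; apply/measurable_EFinP; apply: measurableT_comp => //.
exact: measurable_mart_diff.
Qed.

(** The only dyadic interval of generation 0 is [0,1) itself, of measure 1. *)
Lemma dyadic_mart0 f x : mu.-integrable I01 (EFin \o f) -> I01 x ->
  dyadic_mart f 0 x = \int[mu]_(y in I01) f y.
Proof.
move=> intf x01.
have I0 : dyadic_interval R 0 0 = I01.
  by rewrite /dyadic_interval expr0 !divr1.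
by rewrite /dyadic_mart (@cond_exp_dyadicE _ 0 f 0)// ?I0// expr0 mul1r.
Qed.

Lemma S1_ge f : mu.-integrable I01 (EFin \o f) ->
  {ae mu, forall x, I01 x ->
    (`|f x - \int[mu]_(y in I01) f y|%:E <= S1 f x)%E}.
Proof.
move=> intf; have := dyadic_mart_cvg intf.
apply: ae_imply => x fx x01; rewrite -(dyadic_mart0 intf x01).
have le_S1 n : (`|dyadic_mart f n x - dyadic_mart f 0 x|%:E <= S1 f x)%E.
  have pos k : (1 <= k)%N -> true -> (0 <= `|mart_diff f k x|%:E)%E.
    by rewrite lee_fin.
  (* The upper summation bound is exclusive: [n.+1] keeps exactly d_1, ..., d_n, which telescope to
     f_n - f_0. *)
  apply: le_trans (nneseries_lim_ge n.+1 pos).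
  rewrite sumEFin lee_fin -(telescope_sumr (fun k => dyadic_mart f k x))//.
  by rewrite big_add1 (le_trans (ler_norm_sum _ _ _)).
have {}fx : `|dyadic_mart f n x - dyadic_mart f 0 x| @[n --> \oo] -->
    `|f x - dyadic_mart f 0 x|.
  by apply: cvg_norm; apply: cvgB; [exact: fx|exact: cvg_cst].
have {}fx : `|dyadic_mart f n x - dyadic_mart f 0 x|%:E @[n --> \oo] -->
    `|f x - dyadic_mart f 0 x|%:E.
  by apply: cvg_EFin; [exact: nearW|exact: fx].
rewrite -(cvg_lim _ fx)//; apply: lime_le; first by apply/cvg_ex; eexists; exact: fx.
exact: nearW.
Qed.

(** * The [alpha]-norm on [0,1) and the lower bound for all Borel sets *)

(** Outside [0,1) the integrand is 0^alpha, which is 0 for nonzero [alpha], whereas 0^0 = 1. *)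
Lemma norm01E (alpha : R) (g : R -> \bar R) : alpha != 0 ->
  norm01 alpha g = ((\int[mu]_(x in I01) (`|g x| `^ alpha)) `^ alpha^-1)%E.
Proof.
move=> a0; rewrite /norm01 unlock; congr poweR.
rewrite [RHS]integral_mkcond; apply: eq_integral => x _.
by rewrite !patchE; case: ifPn => // _; rewrite abse0 poweR0r.
Qed.

Lemma measurable_abse_poweR (alpha : R) (g : R -> \bar R) (D : set R) :
  measurable_fun D g -> measurable_fun D (fun x => (`|g x| `^ alpha)%E).
Proof.
move=> mg; apply: (measurableT_comp (measurable_poweR alpha)).
exact: measurableT_comp.
Qed.

(** As [0,1) has measure 1, the constant [c] is its own norm, and the norm is monotone. *)
Lemma norm01_ae_ge_cst (alpha c : R) (g : R -> \bar R) : 0 < alpha -> 0 <= c ->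
  measurable_fun I01 g -> {ae mu, forall x, I01 x -> (c%:E <= `|g x|)%E} ->
  (c%:E <= norm01 alpha g)%E.
Proof.
move=> a0 c0 mg cg; rewrite norm01E ?gt_eqF//.
have -> : c%:E = ((c `^ alpha)%:E `^ alpha^-1)%E.
  by rewrite poweR_EFin -powRrM mulfV ?gt_eqF// powRr1.
apply: gt0_ler_poweR; rewrite ?invr_ge0 ?(ltW a0)//.
- by rewrite in_itv/= leey lee_fin powR_ge0.
- by rewrite in_itv/= leey integral_ge0// => x _; exact: poweR_ge0.
have -> : (c `^ alpha)%:E = (\int[mu]_(x in I01) (cst (c `^ alpha)%:E x))%E.
  by rewrite integral_cst// -[X in (_ * X)%E]/(mu I01) lebesgue_itv01 mule1.
apply: ae_ge0_le_integral => //.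
- by move=> x _; rewrite lee_fin powR_ge0.
- by move=> x _; exact: poweR_ge0.
- exact: measurable_abse_poweR.
apply: ae_imply cg => x cg x01; rewrite -poweR_EFin.
by apply: gt0_ler_poweR; rewrite ?(ltW a0)// ?in_itv/= ?leey ?lee_fin ?c0 ?abse_ge0 ?cg.
Qed.

Lemma lebesgue_star_le_norm01_S1 (alpha : R) A : 0 < alpha ->
  measurable A -> A `<=` I01 ->
  (lebesgue_star A <= norm01 alpha (S1 (\1_A : R -> R)))%E.
Proof.
move=> a0 mA A01; have intA := integrable_indic01 mA.
have muA1 : (mu A <= 1)%E.
  by rewrite -lebesgue_itv01; apply: le_measure; rewrite ?inE.
have muA : mu A \is a fin_num by rewrite ge0_fin_numE// (le_lt_trans muA1) ?ltry.
have intE : \int[mu]_(y in I01) \1_A y = fine (mu A).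
  by rewrite /Rintegral integral_indic//= (setIidl A01).
have := S1_ge intA; rewrite intE /lebesgue_star.
have : 0 <= fine (mu A) by exact: fine_ge0.
move: muA1; rewrite -(fineK muA) lee_fin /=; set a := fine _ => a1 a_ge0 aeS.
rewrite -EFinB -EFin_min.
apply: norm01_ae_ge_cst => //; first by rewrite le_min a_ge0 subr_ge0.
  exact: measurable_S1.
apply: ae_imply aeS => x S1x x01; rewrite gee0_abs ?S1_ge0//.
apply: le_trans (S1x x01); rewrite lee_fin indicE.
(* The deviation of the indicator from its mean [a] is 1 - a on [A] and [a] off [A]; both dominate
   the minimum. *)
have [_|_] := boolP (x \in A); rewrite ?sub0r ?normrN ger0_norm ?subr_ge0//.
  by rewrite ge_min lexx orbT.
by rewrite ge_min lexx.
Qed.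

(** * The dyadic martingale of the indicator of [0, 2^-N) *)

Lemma dyadic_mart_indic n k x A : measurable A -> (k < 2 ^ n)%N ->
  dyadic_interval R n k x ->
  dyadic_mart (\1_A : R -> R) n x =
  2 ^+ n * fine (mu (A `&` dyadic_interval R n k)).
Proof.
move=> mA kn kx; have intA := integrable_indic01 mA.
rewrite /dyadic_mart (cond_exp_dyadicE intA kn kx) /Rintegral integral_indic//.
exact: measurable_dyadic.
Qed.

Lemma fine_lebesgue_dyadic n k : fine (mu (dyadic_interval R n k)) = 2 ^- n.
Proof. by rewrite lebesgue_dyadic. Qed.

Lemma dyadic_mart_indic_ge0 n x A : measurable A -> I01 x ->
  0 <= dyadic_mart (\1_A : R -> R) n x.
Proof.
move=> mA /(mem_dyadic n)[k kn kx]; rewrite (dyadic_mart_indic mA kn kx).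
by rewrite mulr_ge0 ?fine_ge0// ltW// exp2_gt0.
Qed.

Lemma dyadic_interval0E n : dyadic_interval R n 0 = `[0, 2 ^- n[%classic.
Proof. by rewrite /dyadic_interval mul0r div1r. Qed.

(** Among the intervals of generation n <= N, only the leftmost meets [0, 2^-N), so the average
    vanishes elsewhere and is at most 2^n 2^-N there. *)
Lemma dyadic_mart_coarse N n x : (n <= N)%N -> I01 x ->
  dyadic_mart (\1_(dyadic_interval R N 0) : R -> R) n x <=
  2 ^- N * (2 ^+ n * \1_(dyadic_interval R n 0) x).
Proof.
move=> nN /(mem_dyadic n)[k kn kx].
have mN := measurable_dyadic N 0.
rewrite (dyadic_mart_indic mN kn kx) mulrCA ler_pM2l ?exp2_gt0//.
have [k0|k0] := posnP k.
  rewrite k0 in kx *; rewrite indicE mem_set// mulr1 -(fine_lebesgue_dyadic N 0).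
  have le0 : (mu (dyadic_interval R N 0 `&` dyadic_interval R n 0) <=
      mu (dyadic_interval R N 0))%E.
    apply: le_measure; [| |exact: subIsetl]; rewrite inE//.
    by apply: measurableI => //; exact: measurable_dyadic.
  apply: fine_le => //; last by rewrite lebesgue_dyadic.
  by rewrite ge0_fin_numE// (le_lt_trans le0)// lebesgue_dyadic ltry.
(* For k > 0 a common point would satisfy y < 2^-N <= 2^-n <= k / 2^n <= y. *)
rewrite (_ : _ `&` _ = set0); last first.
  rewrite -subset0 dyadic_interval0E => y []; rewrite /dyadic_interval /= !in_itv/=.
  move=> /andP[_ yN] /andP[ky _]; have := le_lt_trans ky yN.
  rewrite ltNge => /negP; apply; apply: (@le_trans _ _ (2 ^- n)).
    by rewrite lef_pV2 ?posrE ?exp2_gt0// ler_eXn2l// ltr1n.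
  by rewrite ler_peMl ?invr_ge0 ?(ltW (exp2_gt0 _))// ler1n.
by rewrite measure0 mulr_ge0// ?indicE ?ler0n// invr_ge0 ltW// exp2_gt0.
Qed.

(** An interval of generation n >= N is either contained in [0, 2^-N) or disjoint from it, so the
    indicator is constant on it and equals its average. *)
Lemma dyadic_mart_fine N n x : (N <= n)%N -> I01 x ->
  dyadic_mart (\1_(dyadic_interval R N 0) : R -> R) n x =
  \1_(dyadic_interval R N 0) x.
Proof.
move=> Nn /(mem_dyadic n)[k kn kx].
have mN := measurable_dyadic N 0.
rewrite (dyadic_mart_indic mN kn kx).
have sub y : dyadic_interval R n k y ->
    (dyadic_interval R N 0 y <-> (k < 2 ^ (n - N))%N).
  (* On the grid of step 2^-n the endpoint 2^-N has index 2^(n-N), which reduces the dichotomy to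
     comparing integers. *)
  have E : 2 ^- N = (2 ^ (n - N))%:R / 2 ^+ n :> R.
    rewrite natrX -[in X in _ / 2 ^+ X](subnK Nn) exprD invfM mulrA.
    by rewrite mulfV ?mul1r// gt_eqF// exp2_gt0.
  rewrite dyadic_interval0E /dyadic_interval /= !in_itv/= E => /andP[ky yk]; split.
    by move=> /andP[_ /(le_lt_trans ky)]; rewrite ltr_pM2r ?invr_gt0 ?exp2_gt0// ltr_nat.
  move=> kN; apply/andP; split.
    by apply: le_trans ky; rewrite divr_ge0// ltW// exp2_gt0.
  by apply: (lt_le_trans yk); rewrite ler_pM2r ?invr_gt0 ?exp2_gt0// ler_nat.
rewrite indicE; have [kN|kN] := ltnP k (2 ^ (n - N)).
  rewrite (setIidr _); last by move=> y ky; apply/(sub y ky).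
  by rewrite fine_lebesgue_dyadic mulfV ?gt_eqF ?exp2_gt0// mem_set//; apply/(sub x kx).
rewrite (_ : _ `&` _ = set0).
  by rewrite measure0 mulr0 memNset// => /(sub x kx); rewrite ltnNge kN.
by rewrite -subset0 => y [Ny] /sub [/(_ Ny)]; rewrite ltnNge kN.
Qed.

Lemma S1_dyadic_le N x : I01 x ->
  (S1 (\1_(dyadic_interval R N 0) : R -> R) x <=
   (\sum_(n < N.+1) 2 * 2 ^- N * 2 ^+ n * \1_(dyadic_interval R n 0) x)%:E)%E.
Proof.
move=> x01; set f : R -> R := \1__; have mN := measurable_dyadic N 0.
rewrite /S1 (@nneseries_split _ _ 1 N); last by move=> k _; rewrite lee_fin.
(* From index N + 1 on, f_n and f_(n-1) are both the indicator, so the tail vanishes. *)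
rewrite eseries0 ?adde0; last first.
  case=> // n Nn _; rewrite /mart_diff !dyadic_mart_fine ?subrr ?normr0//.
  exact: leqW.
rewrite sumEFin lee_fin big_add1.
pose c n : R := 2 ^- N * (2 ^+ n * \1_(dyadic_interval R n 0) x).
have c0 n : 0 <= c n.
  by rewrite !mulr_ge0 ?invr_ge0 ?(ltW (exp2_gt0 _))// indicE.
(* Each |d_(n+1)| is at most f_(n+1) + f_n, and [c] is the bound of [dyadic_mart_coarse]. *)
apply: (@le_trans _ _ (\sum_(0 <= n < N) (c n.+1 + c n))).
  rewrite !big_nat; apply: ler_sum => n /andP[_ nN].
  rewrite /mart_diff /= (le_trans (ler_normB _ _))// lerD//.
    by rewrite ger0_norm ?dyadic_mart_indic_ge0 ?dyadic_mart_coarse.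
  by rewrite ger0_norm ?dyadic_mart_indic_ge0 ?dyadic_mart_coarse// ltnW.
have -> : \sum_(n < N.+1) 2 * 2 ^- N * 2 ^+ n * \1_(dyadic_interval R n 0) x =
    \sum_(n < N.+1) c n + \sum_(n < N.+1) c n.
  by rewrite -big_split/=; apply: eq_bigr => n _; rewrite /c -!mulrA mulr_natl mulr2n.
(* The shifted sum misses [c 0], the other misses [c N]; each is at most the full sum, whence the
   factor 2. *)
rewrite big_split/= !big_mkord lerD//.
  by rewrite [leRHS]big_ord_recl lerDr.
by rewrite big_ord_recr lerDl.
Qed.

(** * Subadditivity of powers and the norm bound for [0, 2^-N) *)

Lemma powR_sum_le (I : Type) (r : seq I) (F : I -> R) (alpha : R) :
  0 < alpha <= 1 -> (forall i, 0 <= F i) ->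
  (\sum_(i <- r) F i) `^ alpha <= \sum_(i <- r) F i `^ alpha.
Proof.
move=> /andP[a0 a1] F0; elim: r => [|i r ih].
  by rewrite !big_nil powR0// gt_eqF.
have powD (s t : R) : 0 <= s -> 0 <= t -> (s + t) `^ alpha <= s `^ alpha + t `^ alpha.
  rewrite le_eqVlt => /predU1P[<- _|s0]; first by rewrite add0r lerDr powR_ge0.
  rewrite le_eqVlt => /predU1P[<-|t0]; first by rewrite addr0 lerDl powR_ge0.
  have st0 : 0 < s + t by exact: addr_gt0.
  (* The ratio t = u / (u + v) lies in (0,1], so t <= t^alpha; the two ratios, for (s, t) and (t,
     s), add up to 1. *)
  have le u v : 0 < u -> 0 < v -> u / (u + v) * (u + v) `^ alpha <= u `^ alpha.
    move=> u0 v0; have uv0 : 0 < u + v by exact: addr_gt0.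
    rewrite -[in leRHS](divfK (lt0r_neq0 uv0) u) powRM ?(ltW uv0) ?divr_ge0 ?(ltW u0) ?(ltW uv0)//.
    rewrite ler_wpM2r ?powR_ge0// ger1_powR// divr_gt0//= ler_pdivrMr// mul1r.
    by rewrite lerDl ltW.
  have := lerD (le s t s0 t0) (le t s t0 s0).
  by rewrite [t + s]addrC -mulrDl -mulrDl mulfV ?gt_eqF// mul1r.
rewrite !big_cons; apply: le_trans (powD _ _ _ _) _ => //; first exact: sumr_ge0.
by rewrite lerD2l.
Qed.

(** Serves to make the geometric ratio 2^(alpha-1) smaller than 1. *)
Lemma gt1_powR_lt1 (a r : R) : 1 < a -> r < 0 -> a `^ r < 1.
Proof.
move=> a1 r0; rewrite lt_neqAle powR_eq1 (gt_eqF a1) (lt_eqF r0) orbF.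
rewrite ltNge (le_trans ler01 (ltW a1))/=.
by rewrite -(powRr0 a) ler_powR// ltW.
Qed.

Lemma norm01_S1_dyadic_le (alpha : R) N : 0 < alpha < 1 ->
  (norm01 alpha (S1 (\1_(dyadic_interval R N 0) : R -> R)) <=
   ((2 `^ alpha / (1 - 2 `^ (alpha - 1))) `^ alpha^-1)%:E *
   mu (dyadic_interval R N 0))%E.
Proof.
move=> /andP[a0 a1]; have mN := measurable_dyadic N 0.
have int1 := integrable_indic01 mN.
(* The ratio combines 2^(n alpha), from the coefficient raised to [alpha], with the measure 2^-n of
   the supporting interval. *)
set q : R := 2 `^ (alpha - 1).
have q1 : q < 1.
  by rewrite gt1_powR_lt1 ?ltr1n// subr_lt0.
have q0 : 0 <= q by exact: powR_ge0.
(* The [n]-th term of the bound in [S1_dyadic_le], raised to [alpha]: an indicator is its own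
   power. *)
pose b n x : R := (2 * 2 ^- N * 2 ^+ n) `^ alpha * \1_(dyadic_interval R n 0) x.
have b0 n x : 0 <= b n x by rewrite mulr_ge0 ?powR_ge0// indicE.
have mb n : measurable_fun I01 (b n).
  by apply: measurable_funM => //; apply: measurable_indic; exact: measurable_dyadic.
have S1b x : I01 x -> (`|S1 (\1_(dyadic_interval R N 0) : R -> R) x| `^ alpha <=
    \sum_(n < N.+1) (b n x)%:E)%E.
  move=> x01; rewrite gee0_abs ?S1_ge0// sumEFin.
  have t0 n : 0 <= 2 * 2 ^- N * 2 ^+ n * \1_(dyadic_interval R n 0) x :> R.
    by rewrite !mulr_ge0 ?invr_ge0 ?(ltW (exp2_gt0 _))// indicE.
  apply: (@le_trans _ _ ((\sum_(n < N.+1) 2 * 2 ^- N * 2 ^+ n *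
      \1_(dyadic_interval R n 0) x)%:E `^ alpha)%E).
    apply: gt0_ler_poweR; rewrite ?(ltW a0)//.
    - by rewrite in_itv/= leey S1_ge0.
    - by rewrite in_itv/= leey lee_fin sumr_ge0.
    - exact: S1_dyadic_le.
  rewrite poweR_EFin lee_fin; apply: le_trans (powR_sum_le _ _ _) _ => //.
    by rewrite a0 ltW.
  apply: ler_sum => n _; rewrite powRM ?indicE ?mulr_ge0 ?invr_ge0 ?(ltW (exp2_gt0 _))//.
  rewrite /b indicE; case: (_ \in _); first by rewrite powR1.
  by rewrite powR0 ?gt_eqF.
have intb n : (\int[mu]_(x in I01) (b n x)%:E)%E =
    ((2 * 2 ^- N) `^ alpha * q ^+ n)%:E.
  under eq_integral do rewrite EFinM.
  rewrite ge0_integralZl//; last first.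
    by apply/measurable_EFinP; apply: measurable_indic; exact: measurable_dyadic.
  rewrite integral_indic//; last exact: measurable_dyadic.
  rewrite setIidl; last by apply: sub_dyadic_itv01; rewrite expn_gt0.
  rewrite -[X in (_ * X)%E]/(mu (dyadic_interval R n 0)) lebesgue_dyadic -EFinM.
  rewrite powRM ?mulr_ge0 ?invr_ge0 ?(ltW (exp2_gt0 _))// -mulrA; congr (_ * _)%:E.
  rewrite -[2 ^+ n]powR_mulrn// -[q ^+ n]powR_mulrn// -!powRrM -powRN -powRD.
    by congr (_ `^ _); lra.
  by rewrite pnatr_eq0 implybT.
have le_int : (\int[mu]_(x in I01) (`|S1 (\1_(dyadic_interval R N 0) : R -> R) x| `^ alpha)
    <= ((2 `^ alpha / (1 - q)) * (2 ^- N) `^ alpha)%:E)%E.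
  apply: (@le_trans _ _ (\int[mu]_(x in I01) (\sum_(n < N.+1) (b n x)%:E))%E).
    apply: ge0_le_integral => //.
    - by move=> x _; exact: poweR_ge0.
    - by apply: measurable_abse_poweR; exact: measurable_S1.
    - by apply: emeasurable_sum => n; apply/measurable_EFinP; exact: mb.
  rewrite ge0_integral_sum//; last 2 first.
  - by move=> n; apply/measurable_EFinP; exact: mb.
  - by move=> n x _; rewrite lee_fin.
  under eq_bigr do rewrite intb.
  rewrite sumEFin lee_fin -mulr_sumr powRM ?invr_ge0 ?(ltW (exp2_gt0 _))//.
  rewrite mulrAC ler_wpM2r ?powR_ge0// ler_wpM2l ?powR_ge0//.
  (* Multiplied by 1 - q, the geometric sum becomes 1 - q^(N+1), which is at most 1. *)
  rewrite -[leRHS]mul1r ler_pdivlMr ?subr_gt0// mulrC.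
  by rewrite -[1 - q]opprB mulNr -subrX1 opprB gerBl exprn_ge0.
rewrite norm01E ?gt_eqF// lebesgue_dyadic -EFinM.
apply: (@le_trans _ _ (((2 `^ alpha / (1 - q)) * (2 ^- N) `^ alpha)%:E `^ alpha^-1)%E).
  apply: gt0_ler_poweR => //; rewrite ?invr_ge0 ?(ltW a0)//.
  - by rewrite in_itv/= leey integral_ge0// => x _; exact: poweR_ge0.
  - by rewrite in_itv/= leey lee_fin !mulr_ge0 ?powR_ge0// invr_ge0 subr_ge0 ltW.
rewrite poweR_EFin powRM ?powR_ge0 ?divr_ge0 ?powR_ge0 ?subr_ge0 ?(ltW q1)//.
(* The outer exponent 1/alpha turns (2^-N)^alpha back into 2^-N, so the bound is linear in the
   measure. *)
by rewrite -powRrM mulfV ?gt_eqF// powRr1// invr_ge0 ltW// exp2_gt0.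
Qed.

End dyadic_martingale.

Theorem theorem1p12 (R : realType) :
  (forall alpha : R, 0 < alpha < 1 ->
     forall A : set R, measurable A -> A `<=` `[0, 1[ ->
       (lebesgue_star A <= norm01 alpha (S1 (\1_A : R -> R)))%E) /\
  (forall alpha : R, 0 < alpha < 1 ->
     exists (C : R) (A_ : nat -> set R),
       [/\ 0 < C,
           forall j, dyadic_algebra R (A_ j),
           forall j, lebesgue_measure (A_ j) != 0%E,
           lebesgue_measure (A_ j) @[j --> \oo] --> 0%E &
           forall j,
             (norm01 alpha (S1 (\1_(A_ j) : R -> R))
                <= C%:E * lebesgue_measure (A_ j))%E]).
Proof.
split=> [alpha /andP[a0 _] A mA A01|alpha a01].
  exact: lebesgue_star_le_norm01_S1.
(* The sets are A_j = [0, 2^-j), each a generator of F_j; the constant is positive because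
   2^(alpha-1) < 1. *)
exists ((2 `^ alpha / (1 - 2 `^ (alpha - 1))) `^ alpha^-1), (dyadic_interval R ^~ 0%N).
split=> [|j|j||j].
- case/andP: a01 => a0 a1; rewrite powR_gt0// divr_gt0 ?powR_gt0// subr_gt0.
  by rewrite gt1_powR_lt1 ?ltr1n// subr_lt0.
- exists j => //; apply: sub_sigma_algebra; exists 0%N => //=.
  by rewrite expn_gt0.
- by rewrite lebesgue_dyadic eqe invr_neq0// gt_eqF// exp2_gt0.
- under eq_cvg do rewrite lebesgue_dyadic.
  by apply: cvg_EFin; [exact: nearW|exact: cvg_exp2V].
- exact: norm01_S1_dyadic_le.
Qed.
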